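(* Let $\varphi$ be a univalent holomorphic self-map of the unit disk $\mathbb{D}$ with $\varphi(0)=0$ and $0<|\varphi'(0)|<1$, and let $0<\alpha<1$ be such that $$\frac{(1-|z|^2)^\alpha\,|\varphi'(z)|}{(1-|\varphi(z)|^2)^\alpha}\le|\varphi'(0)|\qquad\text{for all } z\in\mathbb{D}.$$ Let $u$ be a holomorphic function on $\mathbb{D}$ with $u(0)\ne 0$ and $\|u'\|_\infty=\sup_{z\in\mathbb{D}}|u'(z)|<\infty$. Let $\sigma$ be the Königs function of $\varphi$ and $v$ the principal eigenfunction of $uC_\varphi$. Then the weighted composition operator $uC_\varphi$ is bounded on $\mathcal{B}_\alpha$, and $v\sigma^n\in\mathcal{B}_\alpha$ for all non-negative integers $n$.
   Context: $\mathbb{D}$ is the open unit disk in the complex plane. For $\alpha>0$, the Bloch-type space $\mathcal{B}_\alpha$ is the set of holomorphic $f$ on $\mathbb{D}$ with $\sup_{z\in\mathbb{D}}(1-|z|^2)^\alpha|f'(z)|<\infty$; it is a Banach space under the norm $\|f\|_{\mathcal{B}_\alpha}=|f(0)|+\sup_{z\in\mathbb{D}}(1-|z|^2)^\alpha|f'(z)|$. The weighted composition operator is $uC_\varphi f=u\cdot(f\circ\varphi)$. $\varphi_k$ denotes the $k$-th iterate of $\varphi$ (with $\varphi_0(z)=z$). When $\varphi(0)=0$ and $0<|\varphi'(0)|<1$, the Königs function $\sigma$ of $\varphi$ is the holomorphic function $\sigma=\lim_{k\to\infty}\varphi_k/\varphi'(0)^k$ (the limit exists uniformly on compact subsets of $\mathbb{D}$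 by Königs's theorem); it satisfies $\sigma\circ\varphi=\varphi'(0)\sigma$. When moreover $u(0)\neq0$, the principal eigenfunction $v$ of $uC_\varphi$ is the holomorphic function $v=\lim_{k\to\infty}v_k$ on $\mathbb{D}$, where $v_k(z)=\dfrac{u(z)u(\varphi(z))\cdots u(\varphi_{k-1}(z))}{u(0)^k}$ (the limit is known to exist); it satisfies $u\cdot(v\circ\varphi)=u(0)v$. *)

(* Defs.v *)
From Stdlib Require Import Reals.
From Coquelicot Require Import Coquelicot.

(** Functions on the unit disk are total functions [C -> C] whose values outside
    the disk are irrelevant: every notion below only looks at points of the
    (open) disk. *)
Definition disk (z : C) : Prop := (Cmod z < 1)%R.

Definition holomorphic_on_disk (f : C -> C) : Prop :=
  forall z, disk z -> @ex_derive C_AbsRing C_NormedModule f z.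

Definition self_map_of_disk (phi : C -> C) : Prop :=
  forall z, disk z -> disk (phi z).

Definition univalent_on_disk (f : C -> C) : Prop :=
  holomorphic_on_disk f /\
  forall z w, disk z -> disk w -> f z = f w -> z = w.

Definition sup_disk (g : C -> R) : Rbar :=
  Lub_Rbar (fun x => exists z, disk z /\ x = g z).

(** [Rpower] is the real power of a positive base, and the base is positive on
    the disk. *)
Definition disk_weight (alpha : R) (z : C) : R :=
  Rpower (1 - Cmod z ^ 2) alpha.

Definition bloch_seminorm (alpha : R) (f : C -> C) : Rbar :=
  sup_disk (fun z => (disk_weight alpha z * Cmod (C_derive f z))%R).

Definition in_bloch (alpha : R) (f : C -> C) : Prop :=
  holomorphic_on_disk f /\ Rbar_lt (bloch_seminorm alpha f) p_infty.

(** Only meaningful for [f] in the space, where the supremum is finite; the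
    projection [real] sends infinite values to [0]. *)
Definition bloch_norm (alpha : R) (f : C -> C) : R :=
  (Cmod (f (RtoC 0)) + real (bloch_seminorm alpha f))%R.

Definition weighted_comp (u phi : C -> C) (f : C -> C) : C -> C :=
  fun z => Cmult (u z) (f (phi z)).

Definition bounded_on_bloch (alpha : R) (T : (C -> C) -> C -> C) : Prop :=
  (forall f, in_bloch alpha f -> in_bloch alpha (T f)) /\
  exists M : R, forall f, in_bloch alpha f ->
    (bloch_norm alpha (T f) <= M * bloch_norm alpha f)%R.

Definition iterate (phi : C -> C) (k : nat) (z : C) : C := Nat.iter k phi z.

(** [sigma] is uniquely determined on the disk by [phi]. *)
Definition is_koenigs_function (phi sigma : C -> C) : Prop :=
  holomorphic_on_disk sigma /\
  forall z, disk z ->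
    filterlim
      (fun k => Cdiv (iterate phi k z) (Cpow (C_derive phi (RtoC 0)) k))
      eventually (locally (sigma z)).

(** [u z * u (phi z) * ... * u (phi_(k-1) z)], equal to [1] for [k = 0]. *)
Fixpoint weight_prod (u phi : C -> C) (k : nat) (z : C) : C :=
  match k with
  | O => RtoC 1
  | S j => Cmult (weight_prod u phi j z) (u (iterate phi j z))
  end.

Definition is_principal_eigenfunction (u phi v : C -> C) : Prop :=
  holomorphic_on_disk v /\
  forall z, disk z ->
    filterlim
      (fun k => Cdiv (weight_prod u phi k z) (Cpow (u (RtoC 0)) k))
      eventually (locally (v z)).

(* Main.v *)
Require Import Defs.
From Stdlib Require Import Reals Lra.
From Coquelicot Require Import Coquelicot.

(** Write [w] for the weight [(1 - |z|^2)^alpha] and [l = phi'(0)].  Since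
    [alpha < 1], integrating [|f'| <= S / w] along a radius gives
    [|f - f(0)| <= S / (1 - alpha)]: Bloch functions are bounded, so the space
    is an algebra, and the product and chain rules bound [u C_phi].  Iterating
    the hypothesis gives [w |phi_k'| <= |l|^k], hence [|phi_k| = O(|l|^k)]
    uniformly on the disk.  So [phi_k / l^k] and, since the factors
    [u(phi_j) / u(0)] are [1 + O(|l|^j)], also the products [v_k] satisfy
    [w |f'| <= M] with [M] independent of [k].  Such a bound passes to a merely
    pointwise limit, because it amounts to a local Lipschitz estimate. *)

(** * Complex derivatives: epsilon-delta form and rules of calculus *)

(** The only limit point of the filter [locally z] is [z], so the filter formulation reduces to a
    single estimate at [z]. *)
Lemma is_derive_C_eps (f : C -> C) (z l : C) :
  @is_derive C_AbsRing C_NormedModule f z l <->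
  forall eps : posreal, exists delta : posreal, forall w : C,
    (Cmod (w - z) < delta)%R ->
    (Cmod (f w - f z - (w - z) * l) <= eps * Cmod (w - z))%R.
Proof.
split.
- intros [_ H] eps.
  destruct (H z (fun P HP => HP) eps) as [delta Hd].
  exists delta; exact Hd.
- intros H; split.
  + apply is_linear_scal_l.
  + intros x Hx.
    assert (E := is_filter_lim_locally_unique _ _ Hx); subst x.
    intros eps; destruct (H eps) as [delta Hd].
    exists delta; exact Hd.
Qed.

(** The two module structures on [C] give the same estimate; the general product and chain rules are
    stated for the one coming from the absolute ring. *)
Lemma is_derive_C_regular (f : C -> C) (z l : C) :
  @is_derive C_AbsRing C_NormedModule f z l <->
  @is_derive C_AbsRing (AbsRing_NormedModule C_AbsRing) f z l.
Proof.
split; intros [_ H]; (split; [apply is_linear_scal_l | exact H]).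
Qed.

Lemma is_derive_Cmult (f g : C -> C) (z df dg : C) :
  @is_derive C_AbsRing C_NormedModule f z df ->
  @is_derive C_AbsRing C_NormedModule g z dg ->
  @is_derive C_AbsRing C_NormedModule (fun w : C => Cmult (f w) (g w)) z
    (df * g z + f z * dg)%C.
Proof.
intros Hf Hg; apply is_derive_C_regular.
apply is_derive_C_regular in Hf; apply is_derive_C_regular in Hg.
exact (is_derive_mult (K := C_AbsRing) f g z df dg Hf Hg Cmult_comm).
Qed.

Lemma is_derive_Ccomp (f g : C -> C) (z df dg : C) :
  @is_derive C_AbsRing C_NormedModule f (g z) df ->
  @is_derive C_AbsRing C_NormedModule g z dg ->
  @is_derive C_AbsRing C_NormedModule (fun w : C => f (g w)) z (dg * df)%C.
Proof.
intros Hf Hg; apply is_derive_C_regular in Hg.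
exact (is_derive_comp (K := C_AbsRing) (V := C_NormedModule) f g z df dg Hf Hg).
Qed.

Lemma is_derive_C_id (z : C) :
  @is_derive C_AbsRing C_NormedModule (fun w : C => w) z (RtoC 1).
Proof. apply is_derive_C_regular; exact (is_derive_id (K := C_AbsRing) z). Qed.

Lemma is_derive_C_const (a z : C) :
  @is_derive C_AbsRing C_NormedModule (fun _ : C => a) z (RtoC 0).
Proof. exact (is_derive_const (K := C_AbsRing) (V := C_NormedModule) a z). Qed.

Lemma holomorphic_derive (f : C -> C) (z : C) :
  holomorphic_on_disk f -> disk z ->
  @is_derive C_AbsRing C_NormedModule f z (C_derive f z).
Proof.
intros Hf Hz; exact (C_derive_correct f z z (Hf z Hz)).
Qed.

(** * Mean value inequalities along segments *)

(** Reduces complex increments to real functions of one variable; the factor [c] will be the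
    conjugate of an increment. *)
Lemma is_derive_Re_segment (f : C -> C) (z h c l : C) (t : R) :
  @is_derive C_AbsRing C_NormedModule f (z + RtoC t * h)%C l ->
  is_derive (fun s : R => Re (c * f (z + RtoC s * h))%C) t (Re (c * (l * h))%C).
Proof.
intros H; apply is_derive_Reals; intros eps Heps.
(* The [+ 1] keeps [K] positive when [c] or [h] vanishes; the 2 in [eps / (2 * K)] makes the final
   inequality strict. *)
set (K := (Cmod c * Cmod h + 1)%R).
assert (HK : (0 < K)%R).
{ unfold K; generalize (Cmod_ge_0 c) (Cmod_ge_0 h); intros; 
  assert (0 <= Cmod c * Cmod h)%R by (apply Rmult_le_pos; assumption); lra. }
assert (He : (0 < eps / (2 * K))%R) by (apply Rdiv_lt_0_compat; lra).
destruct (proj1 (is_derive_C_eps _ _ _) H (mkposreal _ He)) as [delta Hd].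
assert (Hh : (0 < Cmod h + 1)%R) by (generalize (Cmod_ge_0 h); lra).
assert (Hd' : (0 < delta / (Cmod h + 1))%R)
  by (apply Rdiv_lt_0_compat; [apply cond_pos | lra]).
exists (mkposreal _ Hd'); intros s Hs Hsd; simpl in Hsd.
assert (E : ((z + RtoC (t + s) * h) - (z + RtoC t * h))%C = (RtoC s * h)%C)
  by (rewrite RtoC_plus; ring).
specialize (Hd (z + RtoC (t + s) * h)%C); rewrite E in Hd.
rewrite Cmod_mult, Cmod_R in Hd.
assert (Hb : (Rabs s * Cmod h < delta)%R).
{ apply Rle_lt_trans with (Rabs s * (Cmod h + 1))%R.
  - apply Rmult_le_compat_l; [apply Rabs_pos | lra].
  - apply (Rmult_lt_compat_r _ _ _ Hh) in Hsd.
    unfold Rdiv in Hsd; rewrite Rmult_assoc, Rinv_l, Rmult_1_r in Hsd by lra.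
    exact Hsd. }
specialize (Hd Hb); simpl in Hd.
set (A := (f (z + RtoC (t + s) * h) - f (z + RtoC t * h) - RtoC s * h * l)%C) in *.
assert (EA : ((Re (c * f (z + RtoC (t + s) * h))%C - Re (c * f (z + RtoC t * h))%C) / s
          - Re (c * (l * h))%C)%R = (Re (c * A)%C / s)%R).
{ unfold A; simpl; unfold Re, Im; simpl. field; exact Hs. }
rewrite EA.
unfold Rdiv; rewrite Rabs_mult, Rabs_inv.
assert (Hs0 : (0 < Rabs s)%R) by (apply Rabs_pos_lt, Hs).
apply (Rmult_lt_reg_r (Rabs s)); [exact Hs0 |].
rewrite Rmult_assoc, Rinv_l, Rmult_1_r by lra.
apply Rle_lt_trans with (Cmod c * (eps / (2 * K) * (Rabs s * Cmod h)))%R.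
{ eapply Rle_trans; [apply re_le_Cmod |].
  rewrite Cmod_mult; apply Rmult_le_compat_l; [apply Cmod_ge_0 | exact Hd]. }
apply Rle_lt_trans with (eps / 2 * Rabs s)%R; [| nra].
replace (Cmod c * (eps / (2 * K) * (Rabs s * Cmod h)))%R
  with (eps / 2 * Rabs s * ((Cmod c * Cmod h) / K))%R by (field; lra).
rewrite <- (Rmult_1_r (eps / 2 * Rabs s)) at 2.
apply Rmult_le_compat_l; [nra |].
apply Rmult_le_reg_r with K; [lra |].
unfold Rdiv; rewrite Rmult_assoc, Rinv_l by lra; unfold K; lra.
Qed.

(** The mean value theorem applied to [g - h], whose derivative is nonnegative. *)
Lemma increment_le (h g dh dg : R -> R) :
  (forall t, 0 <= t <= 1 -> is_derive h t (dh t))%R ->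
  (forall t, 0 <= t <= 1 -> is_derive g t (dg t))%R ->
  (forall t, 0 <= t <= 1 -> dh t <= dg t)%R ->
  (h 1 - h 0 <= g 1 - g 0)%R.
Proof.
intros Hh Hg Hle.
assert (E0 : Rmin 0 1 = 0%R) by (apply Rmin_left; lra).
assert (E1 : Rmax 0 1 = 1%R) by (apply Rmax_right; lra).
assert (D : forall t, (0 <= t <= 1)%R ->
  is_derive (fun s => g s - h s)%R t (dg t - dh t)%R).
{ intros t Ht; apply (is_derive_minus (K := R_AbsRing) (V := R_NormedModule));
    [apply Hg | apply Hh]; exact Ht. }
destruct (MVT_gen (fun s => g s - h s)%R 0 1 (fun t => dg t - dh t)%R)
  as [t [Ht E]].
- rewrite E0, E1; intros t Ht; apply D; lra.
- rewrite E0, E1; intros t Ht; apply continuity_pt_filterlim.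
  apply (ex_derive_continuous (K := R_AbsRing) (V := R_NormedModule)
    (fun s => g s - h s)%R t).
  exists (dg t - dh t)%R; exact (D t Ht).
- rewrite E0, E1 in Ht; specialize (Hle t Ht); nra.
Qed.

(** The derivative is compared with that of a function [g] rather than with a constant, so that a
    bound growing towards the boundary can be integrated. *)
Lemma segment_increment_le (f : C -> C) (z h : C) (g dg : R -> R) :
  holomorphic_on_disk f ->
  (forall t, (0 <= t <= 1)%R -> disk (z + RtoC t * h)) ->
  (forall t, (0 <= t <= 1)%R -> is_derive g t (dg t)) ->
  (forall t, (0 <= t <= 1)%R ->
    (Cmod (C_derive f (z + RtoC t * h)) * Cmod h <= dg t)%R) ->
  (Cmod (f (z + h)%C - f z) <= g 1 - g 0)%R.
Proof.
intros Hf Hd Hg Hle.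
set (D := (f (z + h)%C - f z)%C).
(* This settles the case [D = 0]; otherwise a factor [Cmod D] can be cancelled. *)
assert (Hmono : (0 <= g 1 - g 0)%R).
{ generalize (increment_le (fun _ => 0%R) g (fun _ => 0%R) dg); intros I.
  rewrite Rminus_diag in I; apply I; [| exact Hg |].
  - intros t _; apply (is_derive_const (K := R_AbsRing) (V := R_NormedModule)).
  - intros t Ht; eapply Rle_trans; [| exact (Hle t Ht)].
    apply Rmult_le_pos; apply Cmod_ge_0. }
destruct (Req_dec (Cmod D) 0) as [E | NE]; [rewrite E; exact Hmono |].
assert (HD : (0 < Cmod D)%R) by (generalize (Cmod_ge_0 D); lra).
apply (Rmult_le_reg_l (Cmod D)); [exact HD |].
(* Project on the direction of the increment to use the real mean value theorem. *)
assert (I := increment_le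
  (fun s : R => Re (Cconj D * f (z + RtoC s * h))%C)
  (fun s => Cmod D * g s)%R
  (fun t => Re (Cconj D * (C_derive f (z + RtoC t * h) * h))%C)
  (fun t => Cmod D * dg t)%R).
replace (Cmod D * Cmod D)%R with
  (Re (Cconj D * f (z + RtoC 1 * h))%C - Re (Cconj D * f (z + RtoC 0 * h))%C)%R.
- replace (Cmod D * (g 1 - g 0))%R with (Cmod D * g 1 - Cmod D * g 0)%R by ring.
  apply I.
  + intros t Ht; apply is_derive_Re_segment, holomorphic_derive; auto.
  + intros t Ht; apply is_derive_scal, Hg, Ht.
  + intros t Ht; eapply Rle_trans; [apply Rle_abs |].
    eapply Rle_trans; [apply re_le_Cmod |].
    rewrite !Cmod_mult, Cmod_conj.
    apply Rmult_le_compat_l; [apply Cmod_ge_0 | exact (Hle t Ht)].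
- replace (z + RtoC 1 * h)%C with (z + h)%C by ring.
  replace (z + RtoC 0 * h)%C with z by ring.
  replace (Cmod D * Cmod D)%R with (Cmod D ^ 2)%R by ring.
  rewrite Cmod2_alt; unfold D; simpl; unfold Re, Im; simpl; ring.
Qed.

Lemma Cmod_sub_sym (z w : C) : Cmod (z - w) = Cmod (w - z).
Proof. rewrite <- Cmod_opp; f_equal; ring. Qed.

Lemma Cmod_sub_triangle (z w : C) : (Cmod z <= Cmod w + Cmod (z - w))%R.
Proof.
replace z with (w + (z - w))%C at 1 by ring; apply Cmod_triangle.
Qed.

Lemma disk_0 : disk (RtoC 0).
Proof. unfold disk; rewrite Cmod_0; lra. Qed.

Lemma disk_segment (z w : C) (t : R) :
  disk z -> disk w -> (0 <= t <= 1)%R -> disk (z + RtoC t * (w - z)).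
Proof.
unfold disk; intros Hz Hw Ht.
replace (z + RtoC t * (w - z))%C with (RtoC (1 - t) * z + RtoC t * w)%C
  by (rewrite RtoC_minus; ring).
eapply Rle_lt_trans; [apply Cmod_triangle |].
rewrite !Cmod_mult, !Cmod_R, !Rabs_pos_eq by lra.
generalize (Cmod_ge_0 z) (Cmod_ge_0 w); intros.
destruct (Req_dec t 0) as [-> | Nt]; nra.
Qed.

(** The bound is asked only at points no farther from [z] than [w], so that [L] may be a local
    constant. *)
Lemma derive_bound_lipschitz (f : C -> C) (z w : C) (L : R) :
  holomorphic_on_disk f -> disk z -> disk w ->
  (forall x, disk x -> (Cmod (x - z) <= Cmod (w - z))%R ->
    (Cmod (C_derive f x) <= L)%R) ->
  (Cmod (f w - f z) <= L * Cmod (w - z))%R.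
Proof.
intros Hf Hz Hw HL.
assert (I := segment_increment_le f z (w - z)
  (fun t => t * (L * Cmod (w - z)))%R (fun _ => L * Cmod (w - z))%R).
replace (z + (w - z))%C with w in I by ring.
replace (L * Cmod (w - z))%R
  with (1 * (L * Cmod (w - z)) - 0 * (L * Cmod (w - z)))%R by ring.
apply I; [exact Hf | | |].
- intros t Ht; apply disk_segment; assumption.
- intros t Ht; auto_derive; [exact Logic.I | ring].
- intros t Ht; apply Rmult_le_compat_r; [apply Cmod_ge_0 |].
  apply HL; [apply disk_segment; assumption |].
  replace (z + RtoC t * (w - z) - z)%C with (RtoC t * (w - z))%C by ring.
  rewrite Cmod_mult, Cmod_R, Rabs_pos_eq by lra.
  generalize (Cmod_ge_0 (w - z)); nra.
Qed.

(** * The weight and the growth of Bloch functions *)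

Lemma disk_weight_pos (alpha : R) (z : C) : (0 < disk_weight alpha z)%R.
Proof. apply exp_pos. Qed.

Lemma disk_weight_le_1 (alpha : R) (z : C) :
  (0 <= alpha)%R -> disk z -> (disk_weight alpha z <= 1)%R.
Proof.
unfold disk_weight, disk; intros Ha Hz.
replace 1%R with (Rpower 1 alpha) at 2
  by (unfold Rpower; rewrite ln_1, Rmult_0_r; apply exp_0).
generalize (Cmod_ge_0 z); intros.
apply Rle_Rpower_l; [exact Ha | nra].
Qed.

(** On the radius to [z], with [r = |z|], the weight is at least [(1 - t r)^alpha], and the integral
    of [S r (1 - t r)^(-alpha)] over [[0, 1]] stays below [S / (1 - alpha)] because [alpha < 1]. *)
Lemma bloch_growth (alpha : R) (f : C -> C) (S : R) :
  (0 < alpha < 1)%R -> holomorphic_on_disk f ->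
  (forall z, disk z -> (disk_weight alpha z * Cmod (C_derive f z) <= S)%R) ->
  forall z, disk z -> (Cmod (f z - f (RtoC 0)) <= S / (1 - alpha))%R.
Proof.
intros Ha Hf HS z Hz.
assert (HS0 : (0 <= S)%R).
{ eapply Rle_trans; [| exact (HS _ disk_0)].
  apply Rmult_le_pos; [apply Rlt_le, disk_weight_pos | apply Cmod_ge_0]. }
set (r := Cmod z).
assert (Hr : (0 <= r < 1)%R) by (split; [apply Cmod_ge_0 | exact Hz]).
(* The first function is the antiderivative in [t] of the second. *)
assert (I := segment_increment_le f (RtoC 0) z
  (fun t => - (S / (1 - alpha)) * Rpower (1 - t * r) (1 - alpha))%R
  (fun t => S * / Rpower (1 - t * r) alpha * r)%R).
replace (RtoC 0 + z)%C with z in I by ring.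
eapply Rle_trans; [apply I |].
- exact Hf.
- intros t Ht. replace (0 + RtoC t * z)%C with (RtoC 0 + RtoC t * (z - 0))%C by ring.
  apply disk_segment; [apply disk_0 | exact Hz | exact Ht].
- intros t Ht.
  assert (Hp : (0 < 1 - t * r)%R) by nra.
  replace (S * / Rpower (1 - t * r) alpha * r)%R with
    (- (S / (1 - alpha)) * (- r * ((1 - alpha) * Rpower (1 - t * r) (1 - alpha - 1))))%R.
  + apply is_derive_scal.
    apply (is_derive_comp (K := R_AbsRing) (V := R_NormedModule)
      (fun x => Rpower x (1 - alpha)) (fun t => 1 - t * r)%R).
    * apply is_derive_Reals, derivable_pt_lim_power, Hp.
    * auto_derive; [exact Logic.I | ring].
  + rewrite <- Rpower_Ropp.
    replace (1 - alpha - 1)%R with (- alpha)%R by ring.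
    field; lra.
- intros t Ht; apply Rmult_le_compat_r; [apply Hr |].
  replace (0 + RtoC t * z)%C with (RtoC t * z)%C by ring.
  assert (Em : Cmod (RtoC t * z) = (t * r)%R)
    by (rewrite Cmod_mult, Cmod_R, Rabs_pos_eq by lra; reflexivity).
  assert (Hp : (0 < 1 - t * r)%R) by nra.
  assert (Hw := HS (RtoC t * z)%C); unfold disk in Hw; rewrite Em in Hw.
  specialize (Hw ltac:(lra)).
  assert (P : (0 < Rpower (1 - t * r) alpha)%R) by apply exp_pos.
  apply (Rmult_le_reg_l (Rpower (1 - t * r) alpha)); [exact P |].
  replace (Rpower (1 - t * r) alpha * (S * / Rpower (1 - t * r) alpha))%R
    with S by (field; lra).
  eapply Rle_trans; [| exact Hw].
  apply Rmult_le_compat_r; [apply Cmod_ge_0 |].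
  unfold disk_weight; rewrite Em; apply Rle_Rpower_l; [lra |].
  assert (0 <= t * r)%R by nra; nra.
(* The increment is [S / (1 - alpha)] times [1 - (1 - r)^(1 - alpha)], and the subtracted power is
   positive. *)
- simpl.
  replace (1 - 0 * r)%R with 1%R by ring.
  assert (E1 : Rpower 1 (1 - alpha) = 1%R)
    by (unfold Rpower; rewrite ln_1, Rmult_0_r; apply exp_0).
  rewrite E1.
  assert (P : (0 < Rpower (1 - 1 * r) (1 - alpha))%R) by apply exp_pos.
  assert (Q : (0 <= S / (1 - alpha))%R)
    by (apply Rdiv_le_0_compat; lra).
  nra.
Qed.

(** * Derivative bounds under pointwise limits *)

(** Compare the increment over a small real step [d] with [d * l]. The tolerance in [L + eps] allows
    a Lipschitz constant that only tends to [L] as the neighbourhood shrinks. *)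
Lemma derive_bound_of_lipschitz (f : C -> C) (z l : C) (L : R) :
  @is_derive C_AbsRing C_NormedModule f z l ->
  (forall eps : posreal, exists delta : posreal, forall w : C,
    (Cmod (w - z) < delta)%R ->
    (Cmod (f w - f z) <= (L + eps) * Cmod (w - z))%R) ->
  (Cmod l <= L)%R.
Proof.
intros Hd HL; apply le_epsilon; intros e He.
assert (He2 : (0 < e / 2)%R) by lra.
destruct (proj1 (is_derive_C_eps f z l) Hd (mkposreal _ He2)) as [d1 H1].
destruct (HL (mkposreal _ He2)) as [d2 H2]; simpl in H1, H2.
set (d := (Rmin d1 d2 / 2)%R).
assert (Hd0 : (0 < Rmin d1 d2)%R) by (apply Rmin_pos; apply cond_pos).
assert (Hm1 := Rmin_l d1 d2); assert (Hm2 := Rmin_r d1 d2).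
assert (E : (z + RtoC d - z)%C = RtoC d) by ring.
assert (Ed : Cmod (RtoC d) = d) by (rewrite Cmod_R; apply Rabs_pos_eq; unfold d; lra).
specialize (H1 (z + RtoC d)%C); specialize (H2 (z + RtoC d)%C).
rewrite E, Ed in H1, H2.
specialize (H1 ltac:(unfold d; lra)); specialize (H2 ltac:(unfold d; lra)).
assert (T := Cmod_sub_triangle (RtoC d * l) (f (z + RtoC d)%C - f z)).
rewrite Cmod_mult, Ed, (Cmod_sub_sym (RtoC d * l)) in T.
apply (Rmult_le_reg_l d); [unfold d; lra | lra].
Qed.

Lemma Cmod_limit_le (a : nat -> C) (l : C) (M : R) :
  filterlim a eventually (locally l) ->
  (forall k, (Cmod (a k) <= M)%R) -> (Cmod l <= M)%R.
Proof.
intros Ha HM.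
assert (HN : is_lim_seq (fun k => Cmod (a k)) (Cmod l)).
{ eapply filterlim_comp; [exact Ha |].
  exact (filterlim_norm (V := C_NormedModule) l). }
exact (is_lim_seq_le _ _ _ _ HM HN (is_lim_seq_const M)).
Qed.

(** Near [z] all [a k] share a Lipschitz constant close to [M / w(z)]. This inequality between two
    values survives the pointwise limit, and then bounds the derivative of [f] at [z]. *)
Lemma weighted_derive_limit (alpha : R) (a : nat -> C -> C) (f : C -> C) (M : R) :
  (forall k, holomorphic_on_disk (a k)) ->
  (forall k z, disk z ->
    (disk_weight alpha z * Cmod (C_derive (a k) z) <= M)%R) ->
  (forall z, disk z -> filterlim (fun k => a k z) eventually (locally (f z))) ->
  holomorphic_on_disk f ->
  forall z, disk z -> (disk_weight alpha z * Cmod (C_derive f z) <= M)%R.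
Proof.
intros Ha HM Hlim Hf z Hz.
assert (W := disk_weight_pos alpha z).
cut (Cmod (C_derive f z) <= M / disk_weight alpha z)%R.
{ intros Hle; apply (Rmult_le_compat_l (disk_weight alpha z)) in Hle; [| lra].
  replace (disk_weight alpha z * (M / disk_weight alpha z))%R with M in Hle
    by (field; lra).
  exact Hle. }
apply derive_bound_of_lipschitz with (1 := holomorphic_derive f z Hf Hz).
intros eps.
(* The derivative bound as a function of the modulus; its continuity at [Cmod z] gives the constant
   [G (Cmod z) + eps] nearby. *)
set (G := fun r => (M / Rpower (1 - r ^ 2) alpha)%R).
assert (Hr : (0 <= Cmod z < 1)%R) by (split; [apply Cmod_ge_0 | exact Hz]).
assert (HG : continuous G (Cmod z)).
{ apply (ex_derive_continuous (K := R_AbsRing) (V := R_NormedModule) G).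
  unfold G, Rpower; auto_derive; repeat split; try nra.
  apply Rgt_not_eq, exp_pos. }
destruct (proj1 (filterlim_locally _ _) HG eps) as [d Hd].
(* Within this radius, points stay in the disk and their moduli stay within [d] of [Cmod z]. *)
assert (Hm : (0 < Rmin d (1 - Cmod z))%R)
  by (apply Rmin_pos; [apply cond_pos | lra]).
exists (mkposreal _ Hm); simpl; intros w Hw.
assert (Hl := Rmin_l d (1 - Cmod z)); assert (Hr' := Rmin_r d (1 - Cmod z)).
assert (Hwd : disk w)
  by (unfold disk; generalize (Cmod_sub_triangle w z); lra).
apply (Cmod_limit_le (fun k => a k w - a k z)%C).
- apply (filterlim_comp_2 (H := locally (- f z)%C) (fun k => a k w)
    (fun k => - a k z)%C Cplus (Hlim w Hwd)).
  + eapply filterlim_comp; [exact (Hlim z Hz) |].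
    exact (filterlim_opp (V := C_NormedModule) (f z)).
  + exact (filterlim_plus (V := C_NormedModule) (f w) (- f z)%C).
- intros k; apply derive_bound_lipschitz; [apply Ha | exact Hz | exact Hwd |].
  intros x Hx Hxw.
  assert (B : (Rabs (Cmod x - Cmod z) < d)%R).
  { apply Rle_lt_trans with (Cmod (x - z)); [| lra].
    generalize (Cmod_sub_triangle x z) (Cmod_sub_triangle z x).
    rewrite (Cmod_sub_sym z x); intros; apply Rabs_le; lra. }
  specialize (Hd (Cmod x) B).
  change (Rabs (G (Cmod x) - G (Cmod z)) < eps)%R in Hd.
  apply Rabs_def2 in Hd.
  assert (Wx := disk_weight_pos alpha x).
  apply Rle_trans with (G (Cmod x)).
  + apply (Rmult_le_reg_l (disk_weight alpha x)); [exact Wx |].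
    change (G (Cmod x)) with (M / disk_weight alpha x)%R.
    replace (disk_weight alpha x * (M / disk_weight alpha x))%R with M
      by (field; lra).
    apply HM, Hx.
  + change (M / disk_weight alpha z)%R with (G (Cmod z)); lra.
Qed.

(** * Suprema over the disk and membership in the Bloch space *)

(** The projection [real] is faithful here: [p_infty] is excluded by hypothesis, [m_infty] by the
    value at [z]. *)
Lemma sup_disk_ub (g : C -> R) :
  Rbar_lt (sup_disk g) p_infty ->
  forall z, disk z -> (g z <= real (sup_disk g))%R.
Proof.
intros Hs z Hz; unfold sup_disk in *.
destruct (Lub_Rbar_correct (fun x => exists w, disk w /\ x = g w)) as [U _].
specialize (U (g z) (ex_intro _ z (conj Hz eq_refl))).
destruct (Lub_Rbar _); simpl in *; tauto || lra.
Qed.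

Lemma sup_disk_le (g : C -> R) (M : R) :
  (forall z, disk z -> (g z <= M)%R) ->
  Rbar_lt (sup_disk g) p_infty /\ (real (sup_disk g) <= M)%R.
Proof.
intros HM; unfold sup_disk.
destruct (Lub_Rbar_correct (fun x => exists w, disk w /\ x = g w)) as [U L].
(* The value at 0 excludes [m_infty], which [real] would send to 0. *)
specialize (U (g 0%C) (ex_intro _ _ (conj disk_0 eq_refl))).
specialize (L (Finite M)).
assert (I : Rbar_le (Lub_Rbar (fun x => exists w, disk w /\ x = g w)) M)
  by (apply L; intros x [w [Hw ->]]; exact (HM w Hw)).
destruct (Lub_Rbar _); simpl in *; tauto.
Qed.

Lemma in_bloch_iff (alpha : R) (f : C -> C) :
  in_bloch alpha f <->
  holomorphic_on_disk f /\
  exists M, forall z, disk z ->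
    (disk_weight alpha z * Cmod (C_derive f z) <= M)%R.
Proof.
split; intros [Hf H]; (split; [exact Hf |]).
- eexists; exact (sup_disk_ub _ H).
- destruct H as [M HM]; exact (proj1 (sup_disk_le _ M HM)).
Qed.

(** * Holomorphic functions on the disk and the algebra property of the Bloch space *)

Lemma holomorphic_mult (f g : C -> C) :
  holomorphic_on_disk f -> holomorphic_on_disk g ->
  holomorphic_on_disk (fun z => f z * g z)%C.
Proof.
intros Hf Hg z Hz; eexists.
apply is_derive_Cmult; apply holomorphic_derive; assumption.
Qed.

Lemma derive_mult (f g : C -> C) (z : C) :
  holomorphic_on_disk f -> holomorphic_on_disk g -> disk z ->
  C_derive (fun z => f z * g z)%C z = (C_derive f z * g z + f z * C_derive g z)%C.
Proof.
intros Hf Hg Hz; apply is_C_derive_unique.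
apply is_derive_Cmult; apply holomorphic_derive; assumption.
Qed.

Lemma holomorphic_comp (f g : C -> C) :
  holomorphic_on_disk f -> holomorphic_on_disk g -> self_map_of_disk g ->
  holomorphic_on_disk (fun z => f (g z)).
Proof.
intros Hf Hg Hs z Hz; eexists.
apply is_derive_Ccomp; apply holomorphic_derive; auto.
Qed.

Lemma derive_comp (f g : C -> C) (z : C) :
  holomorphic_on_disk f -> holomorphic_on_disk g -> self_map_of_disk g ->
  disk z ->
  C_derive (fun z => f (g z)) z = (C_derive g z * C_derive f (g z))%C.
Proof.
intros Hf Hg Hs Hz; apply is_C_derive_unique.
apply is_derive_Ccomp; apply holomorphic_derive; auto.
Qed.

Lemma holomorphic_const (c : C) : holomorphic_on_disk (fun _ => c).
Proof. intros z _; eexists; apply is_derive_C_const. Qed.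

Lemma holomorphic_id : holomorphic_on_disk (fun z => z).
Proof. intros z _; eexists; apply is_derive_C_id. Qed.

Lemma holomorphic_div_const (f : C -> C) (c : C) :
  holomorphic_on_disk f -> holomorphic_on_disk (fun z => f z / c)%C.
Proof. intros Hf; apply (holomorphic_mult f); [exact Hf | apply holomorphic_const]. Qed.

Lemma derive_div_const (f : C -> C) (c z : C) :
  holomorphic_on_disk f -> disk z ->
  C_derive (fun z => f z / c)%C z = (C_derive f z / c)%C.
Proof.
intros Hf Hz; unfold Cdiv.
rewrite (derive_mult f (fun _ => / c)%C) by (auto using holomorphic_const).
rewrite (is_C_derive_unique _ _ _ (is_derive_C_const (/ c)%C z)); ring.
Qed.

Lemma bloch_bounded (alpha : R) (f : C -> C) :
  (0 < alpha < 1)%R -> in_bloch alpha f ->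
  exists B, forall z, disk z -> (Cmod (f z) <= B)%R.
Proof.
intros Ha H; apply in_bloch_iff in H; destruct H as [Hf [M HM]].
exists (Cmod (f (RtoC 0)) + M / (1 - alpha))%R; intros z Hz.
generalize (bloch_growth alpha f M Ha Hf HM z Hz).
generalize (Cmod_sub_triangle (f z) (f (RtoC 0))); lra.
Qed.

(** In [w (f g)' = (w f') g + f (w g')] every factor is bounded, [f] and [g] by [bloch_bounded]. *)
Lemma in_bloch_mult (alpha : R) (f g : C -> C) :
  (0 < alpha < 1)%R -> in_bloch alpha f -> in_bloch alpha g ->
  in_bloch alpha (fun z => f z * g z)%C.
Proof.
intros Ha Bf Bg.
destruct (bloch_bounded alpha f Ha Bf) as [F HF].
destruct (bloch_bounded alpha g Ha Bg) as [G HG].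
apply in_bloch_iff in Bf; apply in_bloch_iff in Bg; apply in_bloch_iff.
destruct Bf as [Hf [M HM]]; destruct Bg as [Hg [N HN]].
split; [apply holomorphic_mult; assumption |].
exists (M * G + F * N)%R; intros z Hz.
rewrite derive_mult by assumption.
specialize (HF z Hz); specialize (HG z Hz); specialize (HM z Hz); specialize (HN z Hz).
assert (W := disk_weight_pos alpha z).
assert (T := Cmod_triangle (C_derive f z * g z) (f z * C_derive g z)).
rewrite !Cmod_mult in T.
apply (Rmult_le_compat_l (disk_weight alpha z)) in T; [| lra].
eapply Rle_trans; [exact T |]; rewrite Rmult_plus_distr_l.
apply Rplus_le_compat.
- rewrite <- Rmult_assoc; apply Rmult_le_compat; auto using Cmod_ge_0.
  apply Rmult_le_pos; [lra | apply Cmod_ge_0].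
- replace (disk_weight alpha z * (Cmod (f z) * Cmod (C_derive g z)))%R
    with (Cmod (f z) * (disk_weight alpha z * Cmod (C_derive g z)))%R by ring.
  apply Rmult_le_compat; auto using Cmod_ge_0.
  apply Rmult_le_pos; [lra | apply Cmod_ge_0].
Qed.

(** * Boundedness of the weighted composition operator *)

(** In the derivative of [u (f o phi)], the term with [u'] is controlled by [w <= 1] and the growth
    of [f]; in the other, [w |phi'| <= w(phi)] leaves the weighted derivative of [f] at [phi z]. *)
Lemma weighted_comp_bounded (alpha : R) (phi u : C -> C) (D : R) :
  (0 < alpha < 1)%R ->
  holomorphic_on_disk phi -> self_map_of_disk phi -> phi (RtoC 0) = RtoC 0 ->
  (forall z, disk z ->
    (disk_weight alpha z * Cmod (C_derive phi z) <= disk_weight alpha (phi z))%R) ->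
  holomorphic_on_disk u ->
  (forall z, disk z -> (Cmod (C_derive u z) <= D)%R) ->
  bounded_on_bloch alpha (weighted_comp u phi).
Proof.
intros Ha Hphi Hself Hphi0 Hle Hu HD.
assert (HD0 : (0 <= D)%R)
  by (eapply Rle_trans; [apply Cmod_ge_0 | exact (HD _ disk_0)]).
(* A bound for [u] on the disk, as [|u(z) - u(0)| <= D |z|] and [|z| < 1]. *)
set (U := (Cmod (u (RtoC 0)) + D)%R).
assert (HU : forall z, disk z -> (Cmod (u z) <= U)%R).
{ intros z Hz; unfold U.
  generalize (derive_bound_lipschitz u 0 z D Hu disk_0 Hz (fun x Hx _ => HD x Hx))
    (Cmod_sub_triangle (u z) (u (RtoC 0))).
  replace (z - 0)%C with z by ring; unfold disk in Hz; nra. }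
assert (HU0 : (0 <= U)%R)
  by (eapply Rle_trans; [apply Cmod_ge_0 | exact (HU _ disk_0)]).
assert (Key : forall f, in_bloch alpha f -> forall z, disk z ->
  (disk_weight alpha z * Cmod (C_derive (weighted_comp u phi f) z)
    <= D * (bloch_norm alpha f / (1 - alpha)) + U * bloch_norm alpha f)%R).
{ intros f [Hf Hs] z Hz.
  assert (HM := sup_disk_ub _ Hs); cbv beta in HM.
  fold (bloch_seminorm alpha f) in HM; unfold bloch_norm.
  set (S := real (bloch_seminorm alpha f)) in *.
  assert (HS0 : (0 <= S)%R).
  { eapply Rle_trans; [| exact (HM _ disk_0)].
    apply Rmult_le_pos; [apply Rlt_le, disk_weight_pos | apply Cmod_ge_0]. }
  assert (F0 := Cmod_ge_0 (f (RtoC 0))).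
  assert (W := disk_weight_pos alpha z).
  assert (W1 := disk_weight_le_1 alpha z ltac:(lra) Hz).
  assert (Hp := Hself z Hz).
  unfold weighted_comp.
  rewrite (derive_mult u (fun z => f (phi z))) by (auto using holomorphic_comp).
  rewrite (derive_comp f phi) by assumption.
  eapply Rle_trans;
    [apply Rmult_le_compat_l; [lra | apply Cmod_triangle] |].
  rewrite Rmult_plus_distr_l, !Cmod_mult; apply Rplus_le_compat.
  (* Enlarging [|f(0)|] to [|f(0)| / (1 - alpha)] makes the bound a multiple of the norm. *)
  - assert (B : (Cmod (f (phi z)) <= (Cmod (f (RtoC 0)) + S) / (1 - alpha))%R).
    { assert (G := bloch_growth alpha f S Ha Hf HM _ Hp).
      assert (T := Cmod_sub_triangle (f (phi z)) (f (RtoC 0))).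
      apply Rle_trans with (Cmod (f (RtoC 0)) + S / (1 - alpha))%R; [lra |].
      rewrite Rdiv_plus_distr; apply Rplus_le_compat_r.
      apply (Rmult_le_reg_r (1 - alpha)); [lra |].
      unfold Rdiv; rewrite Rmult_assoc, Rinv_l, Rmult_1_r by lra; nra. }
    rewrite <- Rmult_assoc; apply Rmult_le_compat; try apply Cmod_ge_0.
    + apply Rmult_le_pos; [lra | apply Cmod_ge_0].
    + specialize (HD z Hz); generalize (Cmod_ge_0 (C_derive u z)); nra.
    + exact B.
  - replace (disk_weight alpha z *
      (Cmod (u z) * (Cmod (C_derive phi z) * Cmod (C_derive f (phi z)))))%R
      with (Cmod (u z) * (disk_weight alpha z * Cmod (C_derive phi z)
        * Cmod (C_derive f (phi z))))%R by ring.
    apply Rmult_le_compat; [apply Cmod_ge_0 | | apply HU, Hz |].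
    + apply Rmult_le_pos; [apply Rmult_le_pos; [lra |] |]; apply Cmod_ge_0.
    + apply Rle_trans with S; [| lra].
      eapply Rle_trans; [| exact (HM _ Hp)].
      apply Rmult_le_compat_r; [apply Cmod_ge_0 | apply Hle, Hz]. }
split.
- intros f Bf; apply in_bloch_iff; split.
  + apply (holomorphic_mult u (fun z => f (phi z))); [exact Hu |].
    destruct Bf; apply holomorphic_comp; assumption.
  + eexists; exact (Key f Bf).
(* One [U] comes from the value at 0, where [phi] fixes 0; the rest is the constant in [Key]. *)
- exists (D / (1 - alpha) + 2 * U)%R; intros f Bf.
  destruct (sup_disk_le _ _ (Key f Bf)) as [_ Hsup].
  fold (bloch_seminorm alpha (weighted_comp u phi f)) in Hsup.
  assert (N : (Cmod (f (RtoC 0)) <= bloch_norm alpha f)%R).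
  { destruct Bf as [Hf Hs]; unfold bloch_norm.
    assert (HM := sup_disk_ub _ Hs _ disk_0); cbv beta in HM.
    fold (bloch_seminorm alpha f) in HM.
    assert (0 <= disk_weight alpha 0 * Cmod (C_derive f 0))%R
      by (apply Rmult_le_pos; [apply Rlt_le, disk_weight_pos | apply Cmod_ge_0]).
    lra. }
  unfold bloch_norm at 1; unfold weighted_comp at 1.
  rewrite Hphi0, Cmod_mult.
  assert (P : (Cmod (u (RtoC 0)) * Cmod (f (RtoC 0)) <= U * bloch_norm alpha f)%R)
    by (apply Rmult_le_compat; auto using Cmod_ge_0, disk_0).
  replace ((D / (1 - alpha) + 2 * U) * bloch_norm alpha f)%R with
    (U * bloch_norm alpha f +
     (D * (bloch_norm alpha f / (1 - alpha)) + U * bloch_norm alpha f))%R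
    by (field; lra).
  lra.
Qed.

(** * Iterates of the self-map *)

Lemma iterate_disk (phi : C -> C) (k : nat) :
  self_map_of_disk phi -> self_map_of_disk (iterate phi k).
Proof.
intros Hs z Hz; induction k as [| k IH]; [exact Hz | exact (Hs _ IH)].
Qed.

Lemma iterate_holomorphic (phi : C -> C) (k : nat) :
  holomorphic_on_disk phi -> self_map_of_disk phi ->
  holomorphic_on_disk (iterate phi k).
Proof.
intros Hf Hs; induction k as [| k IH]; [exact holomorphic_id |].
exact (holomorphic_comp phi _ Hf IH (iterate_disk phi k Hs)).
Qed.

Lemma iterate_0 (phi : C -> C) (k : nat) :
  phi (RtoC 0) = RtoC 0 -> iterate phi k (RtoC 0) = RtoC 0.
Proof.
intros H0; induction k as [| k IH]; [reflexivity |].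
change (phi (iterate phi k (RtoC 0)) = RtoC 0); rewrite IH; exact H0.
Qed.

Lemma iterate_derive_bound (alpha rho : R) (phi : C -> C) (k : nat) :
  (0 <= alpha)%R -> (0 <= rho)%R ->
  holomorphic_on_disk phi -> self_map_of_disk phi ->
  (forall z, disk z ->
    (disk_weight alpha z * Cmod (C_derive phi z)
      <= rho * disk_weight alpha (phi z))%R) ->
  forall z, disk z ->
  (disk_weight alpha z * Cmod (C_derive (iterate phi k) z) <= rho ^ k)%R.
Proof.
intros Ha Hrho Hf Hs Hle z Hz.
(* The induction must retain the weight at the iterate, to which the hypothesis is applied next; at
   the end it is bounded by 1. *)
apply Rle_trans with (rho ^ k * disk_weight alpha (iterate phi k z))%R.
- induction k as [| k IH].
  + change (C_derive (iterate phi 0) z) with (C_derive (fun z => z) z).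
    rewrite (is_C_derive_unique _ _ _ (is_derive_C_id z)), Cmod_1.
    change (iterate phi 0 z) with z; simpl; lra.
  + change (iterate phi (S k)) with (fun z => phi (iterate phi k z)); cbv beta.
    assert (Hk := iterate_disk phi k Hs z Hz).
    rewrite (derive_comp phi (iterate phi k))
      by (auto using iterate_holomorphic, iterate_disk).
    rewrite Cmod_mult, <- Rmult_assoc.
    eapply Rle_trans;
      [apply Rmult_le_compat_r; [apply Cmod_ge_0 | exact IH] |].
    rewrite Rmult_assoc.
    eapply Rle_trans;
      [apply Rmult_le_compat_l; [apply pow_le, Hrho | apply Hle, Hk] |].
    simpl; right; ring.
- assert (W1 := disk_weight_le_1 alpha _ Ha (iterate_disk phi k Hs z Hz)).
  generalize (pow_le rho k Hrho); nra.
Qed.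

(** * Uniform estimates for the weight products *)

(** Here [a k] measures the relative deviation of the [k]-th factor from size [m], and [s] is its
    sequence of partial sums. Since [1 + a <= exp a], the product is bounded by an exponential, and
    [s exp s] is a derivative bound stable under induction. *)
Lemma weight_prod_bounds (alpha m : R) (u phi : C -> C) (a s : nat -> R) :
  (0 <= m)%R ->
  (forall k, (0 <= a k)%R) ->
  s 0%nat = 0%R -> (forall k, s (S k) = (s k + a k)%R) ->
  (forall k, holomorphic_on_disk (fun z => u (iterate phi k z))) ->
  (forall k z, disk z -> (Cmod (u (iterate phi k z)) <= m * (1 + a k))%R) ->
  (forall k z, disk z ->
    (disk_weight alpha z * Cmod (C_derive (fun z => u (iterate phi k z)) z)
      <= m * a k)%R) ->
  forall k,
  holomorphic_on_disk (weight_prod u phi k) /\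
  forall z, disk z ->
    (Cmod (weight_prod u phi k z) <= m ^ k * exp (s k))%R /\
    (disk_weight alpha z * Cmod (C_derive (weight_prod u phi k) z)
      <= m ^ k * (s k * exp (s k)))%R.
Proof.
intros Hm Ha s0 sS Hq Hq1 Hq2 k.
assert (Hs : forall k, (0 <= s k)%R).
{ induction k0 as [| j IH]; [lra | rewrite sS; specialize (Ha j); lra]. }
induction k as [| k [Hh IH]].
- split; [exact (holomorphic_const (RtoC 1)) |]; intros z Hz.
  change (weight_prod u phi 0) with (fun _ : C => RtoC 1); cbv beta.
  rewrite (is_C_derive_unique _ _ _ (is_derive_C_const (RtoC 1) z)).
  rewrite s0, exp_0, Cmod_0, Cmod_1; simpl; lra.
- change (weight_prod u phi (S k))
    with (fun z => weight_prod u phi k z * u (iterate phi k z))%C; cbv beta.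
  split; [exact (holomorphic_mult _ _ Hh (Hq k)) |]; intros z Hz.
  rewrite (derive_mult (weight_prod u phi k) (fun z => u (iterate phi k z)))
    by auto.
  destruct (IH z Hz) as [I1 I2]; specialize (Hq1 k z Hz); specialize (Hq2 k z Hz).
  specialize (Ha k); specialize (Hs k); rewrite sS, exp_plus.
  set (p := weight_prod u phi k z) in *; set (q := u (iterate phi k z)) in *.
  set (dp := C_derive (weight_prod u phi k) z) in *.
  set (dq := C_derive (fun z => u (iterate phi k z)) z) in *.
  set (W := disk_weight alpha z) in *.
  assert (HW : (0 < W)%R) by apply disk_weight_pos.
  set (A := a k) in *; set (T := s k) in *; set (E := exp T) in *.
  assert (HE : (0 < E)%R) by apply exp_pos.
  assert (HA : (1 + A <= exp A)%R) by apply exp_ineq1_le.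
  set (F := exp A) in *.
  assert (Hmk := pow_le m k Hm); simpl; set (K := (m ^ k)%R) in *.
  assert (H1 : (0 <= K * E)%R) by (apply Rmult_le_pos; lra).
  assert (H2 : (0 <= m * (K * E))%R) by (apply Rmult_le_pos; lra).
  split.
  + rewrite Cmod_mult.
    apply Rle_trans with ((K * E) * (m * (1 + A)))%R.
    * apply Rmult_le_compat; auto using Cmod_ge_0.
    * replace (m * K * (E * F))%R with (m * (K * E) * F)%R by ring.
      replace (K * E * (m * (1 + A)))%R with (m * (K * E) * (1 + A))%R by ring.
      apply Rmult_le_compat_l; assumption.
  + eapply Rle_trans;
      [apply Rmult_le_compat_l; [lra | apply Cmod_triangle] |].
    rewrite !Cmod_mult.
    apply Rle_trans with (K * (T * E) * (m * (1 + A)) + K * E * (m * A))%R.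
    * replace (W * (Cmod dp * Cmod q + Cmod p * Cmod dq))%R with
        ((W * Cmod dp) * Cmod q + Cmod p * (W * Cmod dq))%R by ring.
      apply Rplus_le_compat; apply Rmult_le_compat; auto using Cmod_ge_0;
        (apply Rmult_le_pos; [lra | apply Cmod_ge_0]).
    * replace (K * (T * E) * (m * (1 + A)) + K * E * (m * A))%R with
        (m * (K * E) * (T * (1 + A) + A))%R by ring.
      replace (m * K * ((T + A) * (E * F)))%R with
        (m * (K * E) * ((T + A) * F))%R by ring.
      (* With [F >= 1 + A] and [F >= 1], one has [T (1 + A) + A <= T F + A F]. *)
      apply Rmult_le_compat_l; [exact H2 | nra].
Qed.

(** * The Königs function and the principal eigenfunction *)

(** The decay [|l|^k] of the weighted derivative of the iterate cancels the normalisation [l^k]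
    exactly, so the uniform bound is 1. *)
Lemma koenigs_in_bloch (alpha : R) (phi sigma : C -> C) :
  (0 <= alpha)%R ->
  holomorphic_on_disk phi -> self_map_of_disk phi ->
  C_derive phi (RtoC 0) <> RtoC 0 ->
  (forall z, disk z ->
    (disk_weight alpha z * Cmod (C_derive phi z)
      <= Cmod (C_derive phi (RtoC 0)) * disk_weight alpha (phi z))%R) ->
  is_koenigs_function phi sigma ->
  in_bloch alpha sigma.
Proof.
intros Ha Hf Hs Hl Hle [Hsig Hlim].
apply in_bloch_iff; split; [exact Hsig |]; exists 1%R.
set (l := C_derive phi (RtoC 0)) in *.
apply (weighted_derive_limit alpha (fun k z => iterate phi k z / l ^ k)%C);
  auto using holomorphic_div_const, iterate_holomorphic.
intros k z Hz.
rewrite (derive_div_const (iterate phi k)) by auto using iterate_holomorphic.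
rewrite Cmod_div, Cmod_pow by (apply Cpow_nz, Hl).
assert (P : (0 < Cmod l ^ k)%R) by (apply pow_lt, Cmod_gt_0, Hl).
unfold Rdiv; rewrite <- Rmult_assoc.
apply (Rmult_le_reg_r (Cmod l ^ k)); [exact P |].
rewrite Rmult_assoc, Rinv_l, Rmult_1_r, Rmult_1_l by lra.
apply iterate_derive_bound; auto using Cmod_ge_0.
Qed.

Lemma principal_in_bloch (alpha rho D : R) (u phi v : C -> C) :
  (0 < alpha < 1)%R -> (0 <= rho < 1)%R ->
  holomorphic_on_disk phi -> self_map_of_disk phi -> phi (RtoC 0) = RtoC 0 ->
  (forall z, disk z ->
    (disk_weight alpha z * Cmod (C_derive phi z)
      <= rho * disk_weight alpha (phi z))%R) ->
  holomorphic_on_disk u -> u (RtoC 0) <> RtoC 0 ->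
  (forall z, disk z -> (Cmod (C_derive u z) <= D)%R) ->
  is_principal_eigenfunction u phi v ->
  in_bloch alpha v.
Proof.
intros Ha Hrho Hf Hs Hf0 Hle Hu Hu0 HD [Hv Hlim].
assert (HD0 : (0 <= D)%R)
  by (eapply Rle_trans; [apply Cmod_ge_0 | exact (HD _ disk_0)]).
set (m := Cmod (u (RtoC 0))).
assert (Hm : (0 < m)%R) by apply Cmod_gt_0, Hu0.
(* From [|u(phi_k) - u(0)| <= D |phi_k| <= D rho^k / (1 - alpha)], the relative deviation of the
   [k]-th factor is at most [c rho^k]. *)
set (c := (D / (1 - alpha) / m)%R).
assert (Hc : (0 <= c)%R) by (unfold c; repeat apply Rdiv_le_0_compat; lra).
assert (Hmc : (m * c = D / (1 - alpha))%R) by (unfold c; field; lra).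
assert (Hpow : forall k, (0 <= rho ^ k)%R) by (intros; apply pow_le, Hrho).
(* Partial sums of the geometric series with terms [c rho^k], bounded by its total
   [c / (1 - rho)]. *)
set (s := fun k => (c * (1 - rho ^ k) / (1 - rho))%R).
assert (Hsk : forall k, (s k <= c / (1 - rho))%R).
{ intros k; unfold s, Rdiv; specialize (Hpow k).
  apply Rmult_le_compat_r; [apply Rlt_le, Rinv_0_lt_compat; lra | nra]. }
assert (Hit : forall k z, disk z ->
  (disk_weight alpha z * Cmod (C_derive (iterate phi k) z) <= rho ^ k)%R)
  by (intros; apply iterate_derive_bound; auto; lra).
assert (B : forall k, holomorphic_on_disk (weight_prod u phi k) /\
  forall z, disk z ->
    (Cmod (weight_prod u phi k z) <= m ^ k * exp (s k))%R /\
    (disk_weight alpha z * Cmod (C_derive (weight_prod u phi k) z)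
      <= m ^ k * (s k * exp (s k)))%R).
{ apply weight_prod_bounds with (a := fun k => (c * rho ^ k)%R).
  - lra.
  - intros k; apply Rmult_le_pos; auto.
  - unfold s; simpl; field; lra.
  - intros k; unfold s; simpl; field; lra.
  - intros k; apply holomorphic_comp; auto using iterate_holomorphic, iterate_disk.
  - intros k z Hz; assert (Hk := iterate_disk phi k Hs z Hz).
    assert (G := bloch_growth alpha (iterate phi k) (rho ^ k) Ha
      (iterate_holomorphic phi k Hf Hs) (Hit k) z Hz).
    rewrite (iterate_0 phi k Hf0) in G.
    assert (L := derive_bound_lipschitz u (RtoC 0) (iterate phi k z) D Hu disk_0 Hk
      (fun x Hx _ => HD x Hx)).
    assert (T := Cmod_sub_triangle (u (iterate phi k z)) (u (RtoC 0))).
    fold m in T.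
    apply Rle_trans with (m + D * (rho ^ k / (1 - alpha)))%R.
    + apply (Rmult_le_compat_l D) in G; lra.
    + right; unfold c; field; lra.
  - intros k z Hz; assert (Hk := iterate_disk phi k Hs z Hz).
    rewrite (derive_comp u (iterate phi k))
      by auto using iterate_holomorphic, iterate_disk.
    rewrite Cmod_mult, <- Rmult_assoc.
    apply Rle_trans with (rho ^ k * D)%R.
    + apply Rmult_le_compat; auto using Cmod_ge_0.
      apply Rmult_le_pos; [apply Rlt_le, disk_weight_pos | apply Cmod_ge_0].
    + rewrite <- Rmult_assoc, Hmc, Rmult_comm.
      apply Rmult_le_compat_r; [apply Hpow |].
      (* What remains is [D <= D / (1 - alpha)]: the same [c] serves for values and derivatives. *)
      apply (Rmult_le_reg_r (1 - alpha)); [lra |].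
      unfold Rdiv; rewrite Rmult_assoc, Rinv_l, Rmult_1_r by lra; nra. }
apply in_bloch_iff; split; [exact Hv |].
(* The bound [s exp s] increases with [s], so the total of the series gives a constant independent
   of [k]. *)
exists (c / (1 - rho) * exp (c / (1 - rho)))%R.
apply (weighted_derive_limit alpha
  (fun k z => weight_prod u phi k z / u (RtoC 0) ^ k)%C); try assumption.
- intros k; apply holomorphic_div_const, B.
- intros k z Hz; destruct (B k) as [Hh Hb]; destruct (Hb z Hz) as [_ Hd].
  rewrite (derive_div_const (weight_prod u phi k)) by assumption.
  rewrite Cmod_div, Cmod_pow by (apply Cpow_nz, Hu0); fold m.
  assert (P : (0 < m ^ k)%R) by (apply pow_lt, Hm).
  unfold Rdiv at 1; rewrite <- Rmult_assoc.
  apply (Rmult_le_reg_r (m ^ k)); [exact P |].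
  rewrite Rmult_assoc, Rinv_l, Rmult_1_r by lra.
  eapply Rle_trans; [exact Hd |]; rewrite Rmult_comm.
  apply Rmult_le_compat_r; [lra |].
  apply Rmult_le_compat; [| apply Rlt_le, exp_pos | apply Hsk |].
  2: { apply Rnot_lt_le; intros H; apply exp_lt_inv in H.
       specialize (Hsk k); lra. }
  unfold s; apply Rdiv_le_0_compat; [| lra].
  apply Rmult_le_pos; [exact Hc |].
  generalize (pow_incr rho 1 k ltac:(lra)); rewrite pow1; lra.
Qed.

Theorem theorem4p2
  (phi u sigma v : C -> C) (alpha : R)
  (phi_univalent : univalent_on_disk phi)
  (phi_self_map : self_map_of_disk phi)
  (phi_0 : phi (RtoC 0) = RtoC 0)
  (dphi_0 : (0 < Cmod (C_derive phi (RtoC 0)) < 1)%R)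
  (alpha_range : (0 < alpha < 1)%R)
  (phi_contract : forall z : C, disk z ->
     (disk_weight alpha z * Cmod (C_derive phi z) / disk_weight alpha (phi z)
        <= Cmod (C_derive phi (RtoC 0)))%R)
  (u_holomorphic : holomorphic_on_disk u)
  (u_0 : u (RtoC 0) <> RtoC 0)
  (du_bounded : Rbar_lt (sup_disk (fun z => Cmod (C_derive u z))) p_infty)
  (sigma_koenigs : is_koenigs_function phi sigma)
  (v_principal : is_principal_eigenfunction u phi v) :
  bounded_on_bloch alpha (weighted_comp u phi) /\
  forall n : nat, in_bloch alpha (fun z => Cmult (v z) (Cpow (sigma z) n)).
Proof.
destruct phi_univalent as [phi_holo _].
assert (HD := sup_disk_ub _ du_bounded); cbv beta in HD.
assert (Hle : forall z, disk z ->
  (disk_weight alpha z * Cmod (C_derive phi z)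
    <= Cmod (C_derive phi (RtoC 0)) * disk_weight alpha (phi z))%R).
{ intros z Hz; assert (W := disk_weight_pos alpha (phi z)).
  apply Rle_div_l; [exact W | exact (phi_contract z Hz)]. }
split.
- apply weighted_comp_bounded with (2 := phi_holo) (7 := HD); try assumption.
  (* Here [|phi'(0)| < 1] lets the contraction factor be replaced by 1. *)
  intros z Hz; eapply Rle_trans; [exact (Hle z Hz) |].
  generalize (disk_weight_pos alpha (phi z)); nra.
- assert (Bsigma : in_bloch alpha sigma).
  { apply koenigs_in_bloch with phi; try assumption; [lra |].
    intros E; rewrite E, Cmod_0 in dphi_0; lra. }
  assert (Bv : in_bloch alpha v)
    by (eapply principal_in_bloch with (6 := Hle) (9 := HD) (phi := phi);
        try eassumption; lra).
  (* By the algebra property only the powers of [sigma] remain, and the same property carries the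
     induction on [n]. *)
  intros n; apply in_bloch_mult; [exact alpha_range | exact Bv |].
  induction n as [| n IH].
  + apply in_bloch_iff; split; [exact (holomorphic_const (RtoC 1)) |].
    exists 0%R; intros z _.
    change (fun z => sigma z ^ 0)%C with (fun _ : C => RtoC 1).
    rewrite (is_C_derive_unique _ _ _ (is_derive_C_const (RtoC 1) z)), Cmod_0; lra.
  + exact (in_bloch_mult alpha sigma _ alpha_range Bsigma IH).
Qed.
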